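(* Let $G$ be a graph. Then $\operatorname{mw}(G)=\omega(G)$, where $\operatorname{mw}(G)$ is the median-width of $G$ and $\omega(G)$ is its clique number.
   Context: Graphs are simple and undirected, and may be finite or infinite. A clique is a set of pairwise adjacent vertices, and the clique number $\omega(G)$ is the size of the largest clique of $G$ (the supremum of the sizes of cliques of $G$). For vertices $u,v$ of a connected graph, $d(u,v)$ is the length of a shortest path (geodesic) from $u$ to $v$, and the interval $I(u,v)$ is the set of vertices $x$ with $d(u,v)=d(u,x)+d(x,v)$, i.e. the vertices lying on some geodesic from $u$ to $v$. A median graph is a connected graph (finite or infinite) in which $I(u,v)\cap I(v,w)\cap I(w,u)$ contains exactly one vertex for every three distinct vertices $u,v,w$. A subgraph $C$ of a graph is convex if every geodesic of the graph with endpoints in $C$ is contained in $C$. A median decomposition of $G$ is a pair $(M,\beta)$, where $M$ is a median graph and $\beta:V(M)\to\mathcal P(V(G))$ is a map such that (M1) $\bigcup_{u\in V(M)}\beta(u)=V(G)$; (M2) for every edge $xy$ of $G$ there exists $u\in V(M)$ with $\{x,y\}\subseteq\beta(u)$; (M3) for every $v\in V(G)$ the set $\beta^{-1}(v)=\{u\in V(M): v\in\beta(u)\}$ induces a convex subgraph of $M$. The width of $(M,\beta)$ is $\sup_{u\in V(M)}|\beta(u)|$. The median-width $\operatorname{mw}(G)$ is the infimum of the widths of all median decompositions of $G$ (with no ''$-1$''). *)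

(* Defs.v *)
From HB Require Import structures.
From mathcomp Require Import all_boot all_order all_algebra.
From mathcomp Require Import boolp classical_sets cardinality reals ereal.
From mathcomp Require Import measure.

Set Implicit Arguments.
Unset Strict Implicit.
Unset Printing Implicit Defensive.

Local Open Scope classical_set_scope.

(* No finiteness is assumed. The choiceType structure and the boolean-valued
   adjacency lose no generality: in classical logic every type carries the
   former ({classic T}) and every relation is boolean. *)
Record sgraph := SGraph {
  vertex :> choiceType;
  adj : rel vertex;
  adj_sym : symmetric adj;
  adj_irr : irreflexive adj
}.

Definition clique (G : sgraph) (K : set G) : Prop :=
  forall x y, K x -> K y -> x != y -> adj x y.

(* [counting A] is the size of A in the extended reals, +oo when A is infinite:
   infinite cardinals are not told apart. *)
Definition clique_number (R : realType) (G : sgraph) : \bar R :=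
  ereal_sup [set counting K | K in [set K : set G | clique K]].

Section Metric.
Variable G : sgraph.
Implicit Types (u v x : G) (p : seq G).

(* The vertices of the path are u :: p, so its length is [size p]. *)
Definition is_path u v p : bool :=
  [&& path (@adj G) u p, last u p == v & uniq (u :: p)].

Definition connected_graph : Prop :=
  [set: G] !=set0 /\ forall u v, exists p, is_path u v p.

Definition geodesic u v p : Prop :=
  is_path u v p /\ forall q, is_path u v q -> (size p <= size q)%N.

(* The default value 0 is only taken when no path joins u to v. *)
Definition dist u v : nat :=
  xget 0%N [set n | exists2 p, geodesic u v p & size p = n].

Definition interval u v : set G :=
  [set x | dist u v = (dist u x + dist x v)%N].

(* Convexity of the subgraph induced by C: such a subgraph contains a path
   as soon as it contains all its vertices. *)
Definition convex (C : set G) : Prop :=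
  forall u v p, C u -> C v -> geodesic u v p ->
    [set x | x \in u :: p] `<=` C.

Definition median_graph : Prop :=
  connected_graph /\
  forall u v w, u <> v -> v <> w -> w <> u ->
    exists! x, (interval u v `&` interval v w `&` interval w u) x.

End Metric.

Definition median_decomposition (G M : sgraph) (beta : M -> set G) : Prop :=
  [/\ median_graph M,
      \bigcup_(u in [set: M]) beta u = [set: G],
      forall x y : G, adj x y -> exists u, [set x; y] `<=` beta u
    & forall v : G, convex [set u | beta u v]].

Definition width (R : realType) (G M : sgraph) (beta : M -> set G) : \bar R :=
  ereal_sup [set counting (beta u) | u in [set: M]].

Definition median_width (R : realType) (G : sgraph) : \bar R :=
  ereal_inf [set w | exists (M : sgraph) (beta : M -> set G),
                       median_decomposition beta /\ w = width R beta].

(* Main.v *)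
(* Upper bound: the finite cliques of G, two of them adjacent when they differ
   by one vertex, form a median graph (the simplex graph) whose distance is the
   size of the symmetric difference, whose intervals are the sets of cliques
   between A `&` B and A `|` B, and whose medians are majorities; each clique
   serves as its own bag. Lower bound: for a finite clique K, the convex sets
   beta^-1(v), v in K, meet pairwise, so by the Helly property of convex sets in
   a median graph some bag contains K. *)
Require Import Defs.
From mathcomp Require Import all_boot all_order all_algebra.
From mathcomp Require Import finmap boolp classical_sets cardinality.
From mathcomp Require Import reals ereal measure.

Set Implicit Arguments.
Unset Strict Implicit.
Unset Printing Implicit Defensive.

Import Order.TTheory GRing.Theory Num.Theory.
Local Open Scope classical_set_scope.

(** * Walks, geodesics and intervals *)

Section Walks.
Variable G : sgraph.
Implicit Types (u v x : G) (p q : seq G).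

Lemma is_path_shorten u p : path (@adj G) u p ->
  exists2 q, is_path u (last u p) q & {subset q <= p} /\ (size q <= size p)%N.
Proof.
case/shortenP=> q uq Uq sqp; exists q; first by rewrite /is_path uq eqxx Uq.
by split=> //; apply: uniq_leq_size => //; case/andP: Uq.
Qed.

Lemma geodesic_size u v p : geodesic u v p -> size p = dist u v.
Proof.
move=> [up minp]; rewrite /dist; case: xgetP => [n _ [q [uq minq] <-]|noP].
  by apply/eqP; rewrite eqn_leq minp ?minq.
by case: (noP (size p)); exists p.
Qed.

Lemma exists_geodesic u v p : is_path u v p -> exists q, geodesic u v q.
Proof.
move=> up; pose P n := `[< exists2 q, is_path u v q & size q = n >].
have exP : exists n, P n by exists (size p); apply/asboolP; exists p.
case: (ex_minnP exP) => n /asboolP[q uq <-] minq.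
by exists q; split=> // r ur; apply: minq; apply/asboolP; exists r.
Qed.

Lemma dist_le_size u p : path (@adj G) u p -> (dist u (last u p) <= size p)%N.
Proof.
move=> /is_path_shorten[q uq [_ qp]].
have [r gr] := exists_geodesic uq.
by rewrite -(geodesic_size gr) (leq_trans _ qp) //; case: gr => _; apply.
Qed.

(** A path extracted from the walk uses only vertices of [u :: p] and is at least as long as [p],
    which leaves no room for a repetition in [u :: p]. *)
Lemma geodesic_walk u p : path (@adj G) u p -> size p = dist u (last u p) ->
  geodesic u (last u p) p.
Proof.
move=> up sz; have minp q : is_path u (last u p) q -> (size p <= size q)%N.
  by case/and3P=> uq /eqP e _; rewrite sz -e dist_le_size.
split=> //; rewrite /is_path up eqxx; change (is_true (uniq (u :: p))).
have [q uq [sqp _]] := is_path_shorten up; have /and3P[_ _ Uq] := uq.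
apply: (leq_size_uniq Uq); last by rewrite /= ltnS minp.
by move=> x; rewrite !inE => /orP[->//|/sqp->]; rewrite orbT.
Qed.

Hypothesis Gconn : connected_graph G.

Lemma connected_geodesic u v : exists p, geodesic u v p.
Proof. by have [_ /(_ u v)[p /exists_geodesic]] := Gconn. Qed.

(** For x in the interval, geodesics from u to x and from x to v concatenate to a walk of length
    [dist u v]. Conversely, the two pieces of a geodesic cut at x are no shorter than the distances
    they span, and the triangle inequality turns this into an equality. *)
Lemma interval_geodesicP u v x :
  Defs.interval u v x <-> exists2 p, geodesic u v p & x \in u :: p.
Proof.
split=> [uvx|[p gp xp]].
  have [[p gp] [q gq]] := (connected_geodesic u x, connected_geodesic x v).
  have [[/and3P[up /eqP lp _] _] [/and3P[xq /eqP lq _] _]] := (gp, gq).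
  have lpq : last u (p ++ q) = v by rewrite last_cat lp.
  exists (p ++ q); last by rewrite -cat_cons mem_cat -lp mem_last.
  rewrite -[X in geodesic _ X]lpq; apply: geodesic_walk.
    by rewrite cat_path up lp.
  by rewrite lpq size_cat (geodesic_size gp) (geodesic_size gq).
have szp := geodesic_size gp.
have [/and3P[up /eqP lp _] _] := gp.
case/splitPl: xp => p1 p2 lx in gp szp up lp *.
move: up; rewrite cat_path => /andP[up1 up2].
move: lp szp; rewrite last_cat size_cat => lp szp.
have d1 := dist_le_size up1; have d2 := dist_le_size up2.
rewrite lx in up2 d1 d2 lp; rewrite lp in d2.
apply/eqP; rewrite /= eqn_leq -{2}szp leq_add // andbT.
have [[q gq] [r gr]] := (connected_geodesic u x, connected_geodesic x v).
have [[/and3P[uq /eqP lq _] _] [/and3P[xr /eqP lr _] _]] := (gq, gr).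
have : path (@adj G) u (q ++ r) by rewrite cat_path uq lq.
move/dist_le_size; rewrite last_cat lq lr size_cat.
by rewrite (geodesic_size gq) (geodesic_size gr).
Qed.

Lemma convex_interval (C : set G) u v :
  convex C -> C u -> C v -> Defs.interval u v `<=` C.
Proof.
by move=> cC Cu Cv x /interval_geodesicP[p gp xp]; apply: cC gp _ xp.
Qed.

End Walks.

(** * The Helly property of convex sets in a median graph *)

Section Helly.
Variable M : sgraph.
Implicit Types A B C : set M.

Lemma convexI A B : convex A -> convex B -> convex (A `&` B).
Proof.
move=> cA cB u v p [Au Bu] [Av Bv] gp x xp.
by split; [apply: cA gp _ xp|apply: cB gp _ xp].
Qed.

Hypothesis Mmed : median_graph M.

(* The median of a point of each pairwise intersection lies in all three
   sets. *)
Lemma helly3 A B C : convex A -> convex B -> convex C ->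
  A `&` B !=set0 -> B `&` C !=set0 -> A `&` C !=set0 ->
  A `&` B `&` C !=set0.
Proof.
move=> cA cB cC [u [Au Bu]] [v [Bv Cv]] [w [Aw Cw]].
have [eqv|/eqP nuv] := eqVneq u v; first by subst v; exists u.
have [eqv|/eqP nvw] := eqVneq v w; first by subst w; exists v.
have [eqv|/eqP nwu] := eqVneq w u; first by subst w; exists u.
have [Mconn /(_ u v w nuv nvw nwu)[x [[[xuv xvw] xwu] _]]] := Mmed.
exists x; split; [split|].
- exact: (convex_interval Mconn cA Aw Au).
- exact: (convex_interval Mconn cB Bu Bv).
- exact: (convex_interval Mconn cC Cv Cw).
Qed.

Lemma helly (I : eqType) (F : I -> set M) (s : seq I) :
  (forall i, convex (F i)) ->
  {in s &, forall i j, F i `&` F j !=set0} ->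
  exists u, {in s, forall i, F i u}.
Proof.
(* The induction carries a convex set [A] that absorbs the members already treated; [helly3] for
   [A], [F i] and [F j] shows that [A] cut down to the head [F i] still meets every later [F j]. It
   starts from the whole graph. *)
move=> cF; suff: forall A, convex A -> A !=set0 ->
    {in s, forall i, A `&` F i !=set0} ->
    {in s &, forall i j, F i `&` F j !=set0} ->
    exists2 u, A u & {in s, forall i, F i u}.
  have [[Mne _] _] := Mmed.
  move=> /(_ setT) H Fij.
  have [//|//|i si|//|u _ Fu] := H; last by exists u.
  by rewrite setTI; have [u [Fu _]] := Fij i i si si; exists u.
elim: s => [|i s IH] A cA A0 AF Fij; first by case: A0 => u; exists u.
have [||j sj|j k sj sk|u [Au Fu] su] := IH (A `&` F i).
- exact: convexI.
- by apply: AF; rewrite mem_head.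
- apply: helly3 => //; first by apply: AF; rewrite mem_head.
    by apply: Fij; rewrite inE ?eqxx ?sj ?orbT.
  by apply: AF; rewrite inE sj orbT.
- by apply: Fij; rewrite inE ?sj ?sk orbT.
- by exists u => // j; rewrite inE => /predU1P[->|/su].
Qed.

End Helly.

(** * The symmetric-difference metric on finite sets *)

Section SymmetricDifference.
Local Open Scope fset_scope.
Variable T : choiceType.
Implicit Types A B X U : {fset T}.

Definition symd A B := #|` (A `\` B) `|` (B `\` A)|.

Lemma symdC A B : symd A B = symd B A.
Proof. by rewrite /symd fsetUC. Qed.

Lemma symd_sum U A B : A `<=` U -> B `<=` U ->
  symd A B = (\sum_(x : U) ((val x \in A) (+) (val x \in B)))%N.
Proof.
move=> /fsubsetP AU /fsubsetP BU.
rewrite -(big_seq_fsetE _ _ predT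
  (fun x => nat_of_bool ((x \in A) (+) (x \in B)))).
rewrite /= -big_mkcond sum1_count -size_filter; apply: perm_size.
apply: uniq_perm; rewrite ?filter_uniq ?fset_uniq // => x.
rewrite mem_filter !inE; move: (AU x) (BU x).
case: (x \in A); case: (x \in B) => //= xA xB; symmetry;
  by [apply: xA|apply: xB].
Qed.

(** With [symd] written as a sum of indicators over a common superset, the inequality is checked
    element by element. Equality holds at an element exactly when X agrees there with A or with B,
    and [leqif_sum] gathers these conditions into betweenness. *)
Lemma symd_leqif A X B :
  (symd A B <= symd A X + symd X B ?= iff
     ((A `&` B `<=` X) && (X `<=` A `|` B)))%N.
Proof.
pose U := A `|` B `|` X.
have [AU BU XU] : [/\ A `<=` U, B `<=` U & X `<=` U].
  by split; apply/fsubsetP=> x; rewrite !inE => ->; rewrite ?orbT.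
rewrite !(@symd_sum U) // -big_split /=.
set b := (b in leqif _ _ b).
have -> : b = [forall x : U,
    [&& ((val x \in A) && (val x \in B)) ==> (val x \in X)
      & (val x \in X) ==> ((val x \in A) || (val x \in B))]].
  apply/idP/forallP => [/andP[/fsubsetP s1 /fsubsetP s2] x|h].
    apply/andP; split; apply/implyP.
      by move=> ABx; apply: s1; rewrite inE.
    by move=> /s2; rewrite inE.
  apply/andP; split; apply/fsubsetP => x.
    rewrite inE => /andP[Ax Bx].
    by have /andP[] := h [` fsubsetP AU x Ax]; rewrite /= Ax Bx.
  move=> Xx; rewrite inE.
  by have /andP[_] := h [` fsubsetP XU x Xx]; rewrite /= Xx.
apply: leqif_sum => x _.
by case: (val x \in A); case: (val x \in B); case: (val x \in X).
Qed.

Lemma symd_triangle A X B : (symd A B <= symd A X + symd X B)%N.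
Proof. by case: (symd_leqif A X B). Qed.

Lemma symd_xx A : symd A A = 0%N.
Proof. by rewrite /symd fsetDv fsetU0 cardfs0. Qed.

Lemma symd_eq0 A B : symd A B = 0%N -> A = B.
Proof.
move/eqP; rewrite cardfs_eq0 fsetU_eq0 !fsetD_eq0 => /andP[AB BA].
by apply/eqP; rewrite eqEfsubset AB.
Qed.

(* One may move from [A] towards [B] one element at a time, first deleting
   [A `\` B] and then adding [B `\` A]: this keeps within subsets of [A] or
   [B]. *)
Lemma symd_step A B n : symd A B = n.+1 ->
  exists X, [/\ symd A X = 1%N, symd X B = n & X `<=` A \/ X `<=` B].
Proof.
(* Betweenness is the equality case of the triangle inequality, so it yields [symd X B = n] without
   a second count. *)
move=> dAB; suff [X [dAX sX leX]]: exists X,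
    [/\ symd A X = 1%N, (A `&` B `<=` X) && (X `<=` A `|` B)
      & X `<=` A \/ X `<=` B].
  exists X; split=> //; move: sX; rewrite -(symd_leqif A X B) dAB dAX.
  by rewrite add1n eqSS => /eqP.
have [AB|] := boolP (A `<=` B).
  have [e|[x]] := fset_0Vmem (B `\` A).
    move: dAB; rewrite /symd e fsetU0; move: AB; rewrite -fsetD_eq0 => /eqP->.
    by rewrite cardfs0.
  rewrite inE => /andP[Ax Bx]; exists (x |` A); split.
  - rewrite /symd -(cardfs1 x); congr #|` _|; apply/fsetP => y; rewrite !inE.
    by have [->|] := eqVneq y x; rewrite ?Ax //=; case: (y \in A).
  - apply/andP; split; apply/fsubsetP => y; rewrite !inE.
      by case/andP=> ->; rewrite orbT.
    by case/predU1P=> [->|->]; rewrite ?Bx ?orbT.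
  - right; apply/fsubsetP => y; rewrite !inE => /predU1P[->//|].
    exact: fsubsetP AB y.
rewrite -fsetD_eq0 => /fset0Pn[x]; rewrite inE => /andP[Bx Ax].
exists (A `\ x); split.
- rewrite /symd -(cardfs1 x); congr #|` _|; apply/fsetP => y; rewrite !inE.
  by have [->|] := eqVneq y x; rewrite ?Ax //=; case: (y \in A).
- apply/andP; split; apply/fsubsetP => y; rewrite !inE.
    by case/andP=> -> By; rewrite andbT; apply: contraNneq Bx => <-.
  by case/andP=> _ ->.
- by left; apply/fsubsetP => y; rewrite !inE => /andP[].
Qed.

Definition majority A B C := (A `&` B) `|` (B `&` C) `|` (C `&` A).

(** At each element at least two of the three sets agree, and lying between those two forces X to
    agree with them. *)
Lemma majorityP A B C X :
  [&& (A `&` B `<=` X) && (X `<=` A `|` B),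
      (B `&` C `<=` X) && (X `<=` B `|` C) &
      (C `&` A `<=` X) && (X `<=` C `|` A)] <-> X = majority A B C.
Proof.
split=> [|->].
  move=> /and3P[/andP[/fsubsetP a1 /fsubsetP b1]
    /andP[/fsubsetP a2 /fsubsetP b2] /andP[/fsubsetP a3 /fsubsetP b3]].
  apply/fsetP => x; move: (a1 x) (b1 x) (a2 x) (b2 x) (a3 x) (b3 x).
  rewrite !inE => /implyP + /implyP + /implyP + /implyP + /implyP + /implyP.
  by case: (x \in A); case: (x \in B); case: (x \in C);
    case: (x \in X) => //=.
apply/and3P; split; apply/andP; split; apply/fsubsetP => x; rewrite !inE;
  by case: (x \in A); case: (x \in B); case: (x \in C).
Qed.

End SymmetricDifference.

(** * The simplex graph and its median decomposition *)

Section SimplexGraph.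
Variable G : sgraph.

(** Being boolean, it makes [fclique] a subtype with injective [val] and the choice structure that
    [sgraph] asks of vertices. *)
Definition is_fclique (K : {fset G}) : bool := `[< clique [set` K] >].

Definition fclique := {K : {fset G} | is_fclique K}.

Definition simplex_adj (A B : fclique) := symd (val A) (val B) == 1%N.

Lemma simplex_adj_sym : symmetric simplex_adj.
Proof. by move=> A B; rewrite /simplex_adj symdC. Qed.

Lemma simplex_adj_irr : irreflexive simplex_adj.
Proof. by move=> A; rewrite /simplex_adj symd_xx. Qed.

Definition simplex_graph := SGraph simplex_adj_sym simplex_adj_irr.

Implicit Types A B C X : simplex_graph.

Lemma fcliqueP A : clique [set` val A].
Proof. by have /asboolP := valP A. Qed.

Lemma sub_fclique (A : fclique) (X : {fset G}) :
  (X `<=` val A)%fset -> is_fclique X.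
Proof.
move=> /fsubsetP XA; apply/asboolP => x y /XA Ax /XA Ay.
exact: (@fcliqueP A x y Ax Ay).
Qed.

Lemma simplex_walk_symd A p :
  path (@adj simplex_graph) A p -> (symd (val A) (val (last A p)) <= size p)%N.
Proof.
elim: p A => [|B p IH] A /=; first by rewrite symd_xx.
case/andP=> /eqP dAB /IH le; apply: leq_trans (symd_triangle _ (val B) _) _.
by rewrite dAB add1n ltnS.
Qed.

Lemma exists_simplex_walk A B :
  exists p, [/\ path (@adj simplex_graph) A p, last A p = B
              & size p = symd (val A) (val B)].
Proof.
move en : (symd (val A) (val B)) => n; elim: n A en => [|n IH] A dAB.
  by exists [::]; split=> //; apply/val_inj/symd_eq0.
have [X [dAX dXB sX]] := symd_step dAB.
(* A set merely between two cliques could fail to be a clique; [symd_step] keeps X inside one of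
   them. *)
have cX : is_fclique X by case: sX; apply: sub_fclique.
have [p [Xp lp sp]] := IH (Sub X cX) dXB.
exists ((Sub X cX : simplex_graph) :: p); split=> //=; rewrite ?sp //.
by rewrite Xp andbT; apply/eqP.
Qed.

Lemma simplex_connected : connected_graph simplex_graph.
Proof.
split=> [|A B].
  have c0 : is_fclique fset0 by apply/asboolP => x y; rewrite /= inE.
  by exists (Sub fset0 c0).
have [p [Ap <- _]] := exists_simplex_walk A B.
by have [q] := is_path_shorten Ap; exists q.
Qed.

Lemma simplex_dist A B : dist A B = symd (val A) (val B).
Proof.
apply/eqP; rewrite eqn_leq; apply/andP; split.
  by have [p [Ap <- <-]] := exists_simplex_walk A B; apply: dist_le_size.
have [p gp] := connected_geodesic simplex_connected A B.
rewrite -(geodesic_size gp); case: gp => /and3P[Ap /eqP<- _] _.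
exact: simplex_walk_symd.
Qed.

Lemma simplex_interval A B X : Defs.interval A B X <->
  ((val A `&` val B `<=` val X) && (val X `<=` val A `|` val B))%fset.
Proof.
rewrite /Defs.interval /= !simplex_dist -(symd_leqif (val A) (val X) (val B)).
by split=> /eqP.
Qed.

(** Pigeonhole: x and y each lie in at least two of the three cliques, hence share one. *)
Lemma majority_fclique A B C : is_fclique (majority (val A) (val B) (val C)).
Proof.
apply/asboolP => x y; rewrite /= !inE => xm ym.
have [[Ax Ay]|[Bx By]|[Cx Cy]] : [\/ (x \in val A) /\ (y \in val A),
    (x \in val B) /\ (y \in val B) | (x \in val C) /\ (y \in val C)].
- move: xm ym; case: (x \in val A); case: (x \in val B); case: (x \in val C);
  case: (y \in val A); case: (y \in val B); case: (y \in val C) => //= _ _;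
  by do ?[by apply: Or31|by apply: Or32|by apply: Or33].
- exact: (@fcliqueP A x y Ax Ay).
- exact: (@fcliqueP B x y Bx By).
- exact: (@fcliqueP C x y Cx Cy).
Qed.

Lemma simplex_median : median_graph simplex_graph.
Proof.
split=> [|A B C _ _ _]; first exact: simplex_connected.
have med X :
    (Defs.interval A B `&` Defs.interval B C `&` Defs.interval C A) X <->
    val X = majority (val A) (val B) (val C).
  rewrite -majorityP; split=> [[[/simplex_interval-> /simplex_interval->]]|].
    by move/simplex_interval->.
  by case/and3P=> *; split; [split|]; apply/simplex_interval.
exists (Sub _ (majority_fclique A B C)); split; first exact/med.
by move=> X /med e; apply: val_inj.
Qed.

Definition simplex_bag (A : simplex_graph) : set G := [set` val A].

Lemma simplex_decomposition : median_decomposition simplex_bag.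
Proof.
(* The case [x = y] gives the covering of vertices, the other case the covering of edges. *)
have bag2 (x y : G) : x = y \/ adj x y ->
    exists u, [set x; y] `<=` simplex_bag u.
  move=> xy; have c2 : is_fclique [fset x; y]%fset.
    apply/asboolP => a b; rewrite /= !inE.
    by case: xy => [<-|xy]; do 2 case/orP=> /eqP->; rewrite ?eqxx // adj_sym.
  by exists (Sub _ c2) => z /= [->|->]; rewrite /simplex_bag /= !inE eqxx ?orbT.
split; first exact: simplex_median.
- rewrite -subTset => x _; have [A xA] := bag2 x x (or_introl erefl).
  by exists A => //; apply: xA; left.
- by move=> x y xy; apply: bag2; right.
move=> v A B p /= vA vB gp X Xp.
(* Every clique on a geodesic from A to B contains their intersection, hence v. *)
have /simplex_interval/andP[/fsubsetP sX _] : Defs.interval A B X.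
  by apply/(interval_geodesicP simplex_connected); exists p.
by apply: sX; rewrite inE; apply/andP.
Qed.

Lemma simplex_width (R : realType) :
  (width R simplex_bag <= clique_number R G)%E.
Proof.
apply: le_ereal_sup => _ [A _ <-]; exists (simplex_bag A) => //.
exact: fcliqueP.
Qed.

End SimplexGraph.

(** * Cliques lie in bags: the lower bound on the width *)

Section LowerBound.
Variables (R : realType) (G M : sgraph) (beta : M -> set G).
Hypothesis dec : median_decomposition beta.

Lemma clique_in_bag (K : {fset G}) :
  clique [set` K] -> exists u, [set` K] `<=` beta u.
Proof.
case: dec => med M1 M2 M3 cK.
have [|u Ku] := @helly _ med _ (fun v => [set u | beta u v]) K M3; last first.
  by exists u => v /Ku.
(* Pairwise intersection: adjacent vertices share a bag, and for a single vertex the covering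
   provides one. *)
move=> x y Kx Ky; have [<-|xy] := eqVneq x y.
  rewrite setIid; have : (\bigcup_(u in setT) beta u) x by rewrite M1.
  by case=> u _ ux; exists u.
have [u xyu] := M2 _ _ (cK _ _ Kx Ky xy).
by exists u; split; apply: xyu; [left|right].
Qed.

Lemma card_clique_le_width (K : {fset G}) :
  clique [set` K] -> ((#|` K|)%:R%:E <= width R beta)%E.
Proof.
move=> /clique_in_bag[u Ku].
have : (counting (beta u) <= width R beta)%E.
  by apply: ereal_sup_ubound; exists u.
apply: le_trans; rewrite /counting; case: asboolP => [fb|_]; last exact: leey.
rewrite lee_fin ler_nat fsubset_leq_card // -[K]set_fsetK.
by rewrite -fset_set_sub //; apply: sub_finite_set fb.
Qed.

Lemma clique_number_le_width : (clique_number R G <= width R beta)%E.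
Proof.
apply: ge_ereal_sup => _ [K cK <-]; rewrite /counting.
case: asboolP => [fK|iK].
  by apply: card_clique_le_width; rewrite fset_setK.
(* An infinite clique has finite subcliques of arbitrarily large size, so the width exceeds every
   real r; size [n.+1] suffices as it is larger than the absolute value of r. *)
rewrite leye_eq; apply/eqP/eq_infty => r.
pose n := Num.truncn `|r|%R.
have [B BK nB] := infinite_set_fset n.+1 iK.
have cB : clique [set` B] by move=> x y /BK Kx /BK Ky; apply: cK.
apply: le_trans (card_clique_le_width cB); rewrite lee_fin.
apply: le_trans (ler_norm r) _; apply: ltW.
by apply: lt_le_trans (truncnS_gt `|r|%R) _; rewrite ler_nat.
Qed.

End LowerBound.

Theorem theorem1p3 (R : realType) (G : sgraph) :
  median_width R G = clique_number R G.
Proof.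
apply/eqP; rewrite eq_le; apply/andP; split.
  apply: le_trans (simplex_width G R); apply: ereal_inf_lbound.
  exists (simplex_graph G), (@simplex_bag G); split=> //.
  exact: simplex_decomposition.
apply: le_ereal_inf_tmp => _ [M [beta [dec ->]]].
exact: clique_number_le_width.
Qed.
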